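(* Let $(M,H,G)$ be an almost hypercomplex NH-manifold belonging to the class $\mathcal{W}_1\oplus\mathcal{W}_3$ with respect to $J_2$ and with respect to $J_3$, i.e. $(M,H,G)\in(\mathcal{W}_1\oplus\mathcal{W}_3)(J_2)\cap(\mathcal{W}_1\oplus\mathcal{W}_3)(J_3)$. If $(M,H,G)$ is a quaternionic Kähler NH-manifold, then it is a Kähler manifold with respect to $J_1$, i.e. $(M,H,G)\in\mathcal{W}_0(J_1)$. Moreover, $$(\nabla_xJ_1)y=0,$$ $$(\nabla_xJ_2)y=\omega_1(x)J_3y,\qquad \omega_1(x)=-\theta_2(J_3x),$$ $$(\nabla_xJ_3)y=-\omega_1(x)J_2y,\qquad \omega_1(x)=\theta_3(J_2x).$$
   Context: $M$ is a smooth manifold of dimension $4n$. An almost hypercomplex structure on $M$ is a triple $H=(J_1,J_2,J_3)$ of almost complex structures with $J_\alpha=J_\beta\circ J_\gamma=-J_\gamma\circ J_\beta$ and $J_\alpha^2=-I$ for all cyclic permutations $(\alpha,\beta,\gamma)$ of $(1,2,3)$. Put $\varepsilon_1=1$, $\varepsilon_2=\varepsilon_3=-1$. An NH-metric structure $G=(g,g_1,g_2,g_3)$ on $(M,H)$ consists of a pseudo-Riemannian metric $g$ of neutral signature $(2n,2n)$ with $g(x,y)=\varepsilon_\alpha g(J_\alpha x,J_\alpha y)$ for $\alpha=1,2,3$, together with $g_\alpha(x,y)=g(J_\alpha x,y)=-\varepsilon_\alpha g(x,J_\alpha y)$. $(M,H,G)$ is then an almost hypercomplex NH-manifold. Let $\nabla$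 be the Levi-Civita connection of $g$. $(M,H,G)$ is a quaternionic Kähler NH-manifold if there are (local) 1-forms $\omega_1,\omega_2,\omega_3$ with $(\nabla_xJ_\alpha)y=\omega_\gamma(x)J_\beta y-\omega_\beta(x)J_\gamma y$ for all cyclic permutations $(\alpha,\beta,\gamma)$ of $(1,2,3)$. Let $F_\alpha(x,y,z)=g((\nabla_xJ_\alpha)y,z)$ and $\theta_\alpha(z)=g^{ij}F_\alpha(e_i,e_j,z)$ for a basis $\{e_i\}$ of the tangent space; $\mathfrak{S}$ denotes the cyclic sum over $x,y,z$. $\mathcal{W}_0(J_\alpha)$ is the class $F_\alpha=0$ ($\alpha=1,2,3$). For $\alpha=2,3$, within the space of tensors satisfying $F(x,y,z)=F(x,z,y)=F(x,J_\alpha y,J_\alpha z)$: $\mathcal{W}_1(J_\alpha)$: $F_\alpha(x,y,z)=\frac{1}{4n}\{g(x,y)\theta_\alpha(z)+g(x,z)\theta_\alpha(y)+g(x,J_\alpha y)\theta_\alpha(J_\alpha z)+g(x,J_\alpha z)\theta_\alpha(J_\alpha y)\}$; $\mathcal{W}_3(J_\alpha)$: $\mathfrak{S}_{x,y,z}F_\alpha(x,y,z)=0$. $(M,H,G)$ belongs to $(\mathcal{W}_1\oplus\mathcal{W}_3)(J_\alpha)$ if at each point $F_\alpha$ is a sum of a tensor satisfying the $\mathcal{W}_1(J_\alpha)$ condition and one satisfying the $\mathcal{W}_3(J_\alpha)$ condition. *)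

(* Defs.v *)
From HB Require Import structures.
From mathcomp Require Import all_boot all_order all_algebra.
From mathcomp Require Import all_classical all_reals all_analysis.

Set Implicit Arguments.
Unset Strict Implicit.
Unset Printing Implicit Defensive.

Import Order.TTheory GRing.Theory Num.Theory.
Import numFieldNormedType.Exports.

Local Open Scope classical_set_scope.
Local Open Scope ring_scope.

(* The libraries have no smooth manifolds.  A manifold is given below by an
   indexed smooth atlas; a tensor field is given by its components in every
   chart of the atlas, subject to the transformation law under change of
   charts.  Tangent vectors in a chart are column vectors. *)

Section Smooth.
Context {R : realType} {m : nat} {V : normedModType R}.
Implicit Types (A : set 'cV[R]_m) (f : 'cV[R]_m -> V).

Fixpoint Ck_on (k : nat) A f : Prop :=
  (forall u, A u -> {for u, continuous f}) /\
  if k is k'.+1 then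
    forall v, (forall u, A u -> derivable f u v) /\
              Ck_on k' A (fun u => 'D_v f u)
  else True.

(* intended for open A only *)
Definition smooth_on A f := forall k, Ck_on k A f.

End Smooth.

(* A homeomorphism from the open set [source] onto the open set [target];
   the values of [fwd] and [bwd] outside of these sets are irrelevant. *)
Record chart (R : realType) (m : nat) (X : topologicalType) := Chart {
  source : set X;
  target : set 'cV[R]_m;
  fwd : X -> 'cV[R]_m;
  bwd : 'cV[R]_m -> X;
  open_source : open source;
  open_target : open target;
  fwd_target : forall p, source p -> target (fwd p);
  bwd_source : forall u, target u -> source (bwd u);
  fwdK : forall p, source p -> bwd (fwd p) = p;
  bwdK : forall u, target u -> fwd (bwd u) = u;
  fwd_continuous : forall p, source p -> {for p, continuous fwd};
  bwd_continuous : forall u, target u -> {for u, continuous bwd} }.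

Record manifold (R : realType) (m : nat) := Manifold {
  carrier :> topologicalType;
  chart_index : Type;
  chart_of : chart_index -> chart R m carrier;
  manifold_hausdorff : hausdorff_space carrier;
  manifold_second_countable : @second_countable carrier;
  chart_cover : forall p : carrier, exists i, source (chart_of i) p;
  transition_smooth : forall i j,
    smooth_on (target (chart_of i) `&` bwd (chart_of i) @^-1` source (chart_of j))
              (fwd (chart_of j) \o bwd (chart_of i)) }.

Section Tensors.
Context {R : realType} {m : nat} (M : manifold R m).
Local Notation E := 'cV[R]_m.
Local Notation ix := (chart_index M).

Definition chart_im (i : ix) : set E := target (chart_of i).

Definition point_at (i : ix) : E -> M := bwd (chart_of i).

Definition overlap (i j : ix) : set E :=
  chart_im i `&` point_at i @^-1` source (chart_of j).

Definition transition (i j : ix) : E -> E := fwd (chart_of j) \o point_at i.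

(* differential of the change of charts, on tangent vectors *)
Definition dtransition (i j : ix) (u : E) (x : E) : E :=
  'D_x (transition i j) u.

(* smooth (1,1)-tensor fields, i.e. fields of endomorphisms of TM *)
Record endo_field := EndoField {
  endo_comp :> ix -> E -> 'M[R]_m;
  endo_smooth : forall i, smooth_on (chart_im i) (endo_comp i);
  endo_law : forall i j u (x : E), overlap i j u ->
    endo_comp j (transition i j u) *m dtransition i j u x =
    dtransition i j u (endo_comp i u *m x) }.

Definition bilin (g : 'M[R]_m) (x y : E) : R := (x^T *m g *m y) 0 0.

Definition has_signature (p q : nat) (g : 'M[R]_m) : Prop :=
  (p + q = m)%N /\
  exists2 P : 'M[R]_m, P \in unitmx &
    P^T *m g *m P = diag_mx (\row_(k < m) (if (k < p)%N then 1 else -1)).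

(* pseudo-Riemannian metrics of signature (p, q); non-degeneracy follows from
   [metric_signature] *)
Record metric (p q : nat) := Metric {
  metric_comp :> ix -> E -> 'M[R]_m;
  metric_smooth : forall i, smooth_on (chart_im i) (metric_comp i);
  metric_law : forall i j u (x y : E), overlap i j u ->
    bilin (metric_comp j (transition i j u))
          (dtransition i j u x) (dtransition i j u y) =
    bilin (metric_comp i u) x y;
  metric_sym : forall i u (x y : E), chart_im i u ->
    bilin (metric_comp i u) x y = bilin (metric_comp i u) y x;
  metric_signature : forall i u, chart_im i u -> has_signature p q (metric_comp i u) }.

(* smooth 1-forms on the subset U of M (meant to be open) *)
Record one_form (U : set M) := OneForm {
  form_comp :> ix -> E -> 'rV[R]_m;
  form_smooth : forall i,
    smooth_on (chart_im i `&` point_at i @^-1` U) (form_comp i);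
  form_law : forall i j u (x : E), overlap i j u -> U (point_at i u) ->
    form_comp j (transition i j u) *m dtransition i j u x =
    form_comp i u *m x }.

Definition form_eval (U : set M) (w : one_form U) (i : ix) (u x : E) : R :=
  (w i u *m x) 0 0.

(* Affine connections, given by their Christoffel symbols
   Gamma_i(u)(x, y) = x^a y^b Gamma^c_(ab)(u) e_c in the chart i.
   [conn_law] is what makes [cov] below independent of the chart. *)
Record connection := Connection {
  Gamma : ix -> E -> E -> E -> E;
  conn_linear_l : forall i u y, chart_im i u -> linear (fun x => Gamma i u x y);
  conn_linear_r : forall i u x, chart_im i u -> linear (Gamma i u x);
  conn_smooth : forall i x y, smooth_on (chart_im i) (fun u => Gamma i u x y);
  conn_law : forall i j u x y, overlap i j u ->
    Gamma j (transition i j u) (dtransition i j u x) (dtransition i j u y) =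
    dtransition i j u (Gamma i u x y) -
    'D_x (fun v => dtransition i j v y) u }.

(* (nabla_x Y) at the point u of the chart i, for a vector field Y *)
Definition cov (D : connection) (i : ix) (u x : E) (Y : E -> E) : E :=
  'D_x Y u + Gamma D i u x (Y u).

(* nabla_X Y - nabla_Y X = [X, Y] *)
Definition torsion_free (D : connection) : Prop :=
  forall i (X Y : E -> E), smooth_on (chart_im i) X -> smooth_on (chart_im i) Y ->
  forall u, chart_im i u ->
    cov D i u (X u) Y - cov D i u (Y u) X = 'D_(X u) Y u - 'D_(Y u) X u.

(* x(g(Y, Z)) = g(nabla_x Y, Z) + g(Y, nabla_x Z) *)
Definition metric_compatible p q (g : metric p q) (D : connection) : Prop :=
  forall i (Y Z : E -> E), smooth_on (chart_im i) Y -> smooth_on (chart_im i) Z ->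
  forall u x, chart_im i u ->
    'D_x (fun v => bilin (g i v) (Y v) (Z v)) u =
    bilin (g i u) (cov D i u x Y) (Z u) + bilin (g i u) (Y u) (cov D i u x Z).

Definition levi_civita p q (g : metric p q) (D : connection) : Prop :=
  torsion_free D /\ metric_compatible g D.

(* (nabla_x J) y = nabla_x (J Y) - J (nabla_x Y) for any vector field Y with
   value y at u; the one with constant components is used *)
Definition cov_endo (D : connection) (J : endo_field) (i : ix) (u x y : E) : E :=
  cov D i u x (fun v => J i v *m y) - J i u *m cov D i u x (fun=> y).

End Tensors.

Variant hindex := I1 | I2 | I3.

(* cyclic permutations of (1, 2, 3) *)
Variant cyclic : hindex -> hindex -> hindex -> Prop :=
| Cyc123 : cyclic I1 I2 I3
| Cyc231 : cyclic I2 I3 I1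
| Cyc312 : cyclic I3 I1 I2.

Definition eps (R : pzRingType) (a : hindex) : R := if a is I1 then 1 else -1.

Record almost_hypercomplex (R : realType) (m : nat) (M : manifold R m) :=
  AlmostHypercomplex {
    Jstr :> hindex -> endo_field M;
    Jstr_mul : forall a b c i u, cyclic a b c -> chart_im i u ->
      Jstr a i u = Jstr b i u *m Jstr c i u;
    Jstr_anti : forall a b c i u, cyclic a b c -> chart_im i u ->
      Jstr a i u = - (Jstr c i u *m Jstr b i u);
    Jstr_sq : forall a i u, chart_im i u -> Jstr a i u *m Jstr a i u = - 1%:M }.

Record nh_metric (R : realType) (n : nat) (M : manifold R (4 * n))
    (H : almost_hypercomplex M) := NHMetric {
  nh_g :> metric M (2 * n) (2 * n);
  nh_compat : forall a i u x y, chart_im i u ->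
    bilin (nh_g i u) x y =
    eps R a * bilin (nh_g i u) (H a i u *m x) (H a i u *m y) }.

Section NHManifolds.
Context {R : realType} {n : nat} {M : manifold R (4 * n)}.
Context {H : almost_hypercomplex M} (G : nh_metric H) (D : connection M).
Local Notation E := 'cV[R]_(4 * n).
Local Notation ix := (chart_index M).
Local Notation tensor3 := (E -> E -> E -> R).

(* the associated metrics of the NH-structure (g, g_1, g_2, g_3), which are
   determined by g and H *)
Definition nh_assoc (a : hindex) (i : ix) (u x y : E) : R :=
  bilin (G i u) (H a i u *m x) y.

Definition Ften (a : hindex) (i : ix) (u : E) : tensor3 :=
  fun x y z => bilin (G i u) (cov_endo D (H a) i u x y) z.

(* g^(jk) F(e_j, e_k, z) in the coordinate basis *)
Definition trace12 (i : ix) (u : E) (F : tensor3) (z : E) : R :=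
  \sum_(j < 4 * n) \sum_(k < 4 * n)
    invmx (G i u) j k * F (delta_mx j 0) (delta_mx k 0) z.

Definition theta (a : hindex) (i : ix) (u z : E) : R :=
  trace12 i u (Ften a i u) z.

Definition trilinear (F : tensor3) : Prop :=
  [/\ forall y z, scalar (fun x => F x y z),
      forall x z, scalar (fun y => F x y z) &
      forall x y, scalar (fun z => F x y z)].

(* the ambient space of tensors at a point; for a = 2, 3 only *)
Definition F_space (a : hindex) (i : ix) (u : E) (F : tensor3) : Prop :=
  [/\ trilinear F,
      forall x y z, F x y z = F x z y &
      forall x y z, F x y z = F x (H a i u *m y) (H a i u *m z)].

Definition W1_tensor (a : hindex) (i : ix) (u : E) (F : tensor3) : Prop :=
  let g := bilin (G i u) in let J := mulmx (H a i u) in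
  let th := trace12 i u F in
  F_space a i u F /\
  forall x y z, F x y z =
    (4 * n)%:R^-1 * (g x y * th z + g x z * th y
                     + g x (J y) * th (J z) + g x (J z) * th (J y)).

Definition W3_tensor (a : hindex) (i : ix) (u : E) (F : tensor3) : Prop :=
  F_space a i u F /\ forall x y z, F x y z + F y z x + F z x y = 0.

Definition in_W0 (a : hindex) : Prop :=
  forall i u x y z, chart_im i u -> Ften a i u x y z = 0.

(* for a = 2, 3 only *)
Definition in_W1_W3 (a : hindex) : Prop :=
  forall i u, chart_im i u ->
  exists A B : tensor3, [/\ W1_tensor a i u A, W3_tensor a i u B &
    forall x y z, Ften a i u x y z = A x y z + B x y z].

End NHManifolds.

Section QuaternionicKahler.
Context {R : realType} {m : nat} {M : manifold R m}.
Context (H : almost_hypercomplex M) (D : connection M).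
Local Notation E := 'cV[R]_m.

Definition qk_forms (U : set M) (w : hindex -> one_form U) : Prop :=
  forall a b c, cyclic a b c ->
  forall i u (x y : E), chart_im i u -> U (point_at i u) ->
    cov_endo D (H a) i u x y =
    form_eval (w c) i u x *: (H b i u *m y)
    - form_eval (w b) i u x *: (H c i u *m y).

Definition quaternionic_kahler : Prop :=
  forall p : M, exists (U : set M) (w : hindex -> one_form U),
    [/\ open U, U p & qk_forms w].

End QuaternionicKahler.

(* Main.v *)
Require Import Defs.
From HB Require Import structures.
From mathcomp Require Import all_boot all_order all_algebra.
From mathcomp Require Import all_classical all_reals all_analysis.

Set Implicit Arguments.
Unset Strict Implicit.
Unset Printing Implicit Defensive.

Import Order.TTheory GRing.Theory Num.Theory.
Import numFieldNormedType.Exports.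

Local Open Scope classical_set_scope.
Local Open Scope ring_scope.

(** The statement is pointwise linear algebra.  The compatibility of g with H
    makes J_1 skew-adjoint and J_2, J_3 self-adjoint for g ([Jstr_adjoint]).
    By the quaternionic Kaehler condition,
      F_2(x, y, z) = omega_1(x) g(J_3 y, z) - omega_3(x) g(J_1 y, z),
      F_3(x, y, z) = omega_2(x) g(J_1 y, z) - omega_1(x) g(J_2 y, z),
    so in each case one summand is symmetric in y, z and the other one is
    alternating.  Membership in W_1 + W_3 forces F_2 and F_3 to be symmetric in
    y, z, so the alternating summands vanish ([skew_part_eq0]), and
    non-degeneracy of g turns this into omega_2 = omega_3 = 0
    ([qk_form_eq0_scale]).  What is left of the quaternionic Kaehler condition is
      nabla J_1 = 0,  nabla J_2 = omega_1 J_3,  nabla J_3 = - omega_1 J_2.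
    Finally, the trace of omega(x) g(A y, z) over x and y is omega(A z) for a
    self-adjoint A ([trace12_form_bilin]), whence theta_2(z) = omega_1(J_3 z)
    and theta_3(z) = - omega_1(J_2 z); replacing z by J_3 x, resp. J_2 x, and
    using J_a^2 = - I gives the two formulas for omega_1.

    The vanishing of a 1-form omega is expressed as omega(x) v = 0 for all
    vectors v.  This is what the formulas for nabla J_a use, and it makes
    sense of the argument in dimension 0 as well, where no scalar can be
    cancelled against a nonzero vector. *)

Section Bilinear.
Context {R : realType} {m : nat}.
Implicit Types (g A B : 'M[R]_m) (x y z : 'cV[R]_m) (c : R).

Lemma bilinDl g x y z : bilin g (x + y) z = bilin g x z + bilin g y z.
Proof. by rewrite /bilin linearD /= !mulmxDl mxE. Qed.

Lemma bilinZl g c x z : bilin g (c *: x) z = c * bilin g x z.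
Proof. by rewrite /bilin linearZ /= -!scalemxAl mxE. Qed.

Lemma bilinNl g x z : bilin g (- x) z = - bilin g x z.
Proof. by rewrite -scaleN1r bilinZl mulN1r. Qed.

Lemma bilin_delta g (k : 'I_m) z : bilin g (delta_mx k 0) z = (g *m z) k 0.
Proof. by rewrite /bilin trmx_delta -mulmxA -rowE mxE. Qed.

Lemma has_signature_unitmx p q g : has_signature p q g -> g \in unitmx.
Proof.
case=> _ [P uP eqP_diag].
have : P^T *m g *m P \in unitmx.
  rewrite eqP_diag unitmxE det_diag unitfE; apply/prodf_neq0 => k _.
  by rewrite mxE; case: ifP => _; rewrite ?oppr_eq0 oner_eq0.
by rewrite !unitmx_mul => /andP[/andP[_ ug] _].
Qed.

Lemma bilin_nondegenerate g x :
  g \in unitmx -> (forall z, bilin g x z = 0) -> x = 0.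
Proof.
move=> ug x0.
have xg0 : x^T *m g = 0.
  apply/rowP => k; have := x0 (delta_mx k 0).
  by rewrite /bilin -colE mxE => ->; rewrite mxE.
by apply: trmx_inj; rewrite -(mulmxK ug x^T) xg0 mul0mx trmx0.
Qed.

(** Exchanging y and z in g((a A + b B) y, z) fixes the [A]-term and changes the
    sign of the [B]-term, so symmetry makes the latter equal to its opposite. *)
Lemma skew_part_eq0 g A B (a b : R) :
    g \in unitmx -> (forall x y, bilin g x y = bilin g y x) ->
    (forall x y, bilin g (A *m x) y = bilin g x (A *m y)) ->
    (forall x y, bilin g (B *m x) y = - bilin g x (B *m y)) ->
    (forall y z, bilin g (a *: (A *m y) + b *: (B *m y)) z =
                 bilin g (a *: (A *m z) + b *: (B *m z)) y) ->
  forall y, b *: (B *m y) = 0.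
Proof.
move=> ug gC adjA adjB symAB y; apply: (bilin_nondegenerate ug) => z.
have := symAB y z; rewrite !bilinDl !bilinZl.
rewrite (gC (A *m z)) -adjA (gC (B *m z)) => /addrI.
rewrite -[bilin g y _]opprK -adjB mulrN => /eqP.
by rewrite -addr_eq0 -mulr2n mulrn_eq0 /= => /eqP.
Qed.

(** Contracting with the inverse of [g] raises the index that pairs with [w]:
    as g(A e_k, z) = g(e_k, A z), the sum is [w] applied to g^-1 g (A z). *)
Lemma trace12_form_bilin g A (w : 'rV[R]_m) z :
    g \in unitmx -> (forall x y, bilin g (A *m x) y = bilin g x (A *m y)) ->
  \sum_(j < m) \sum_(k < m) invmx g j k *
     ((w *m (delta_mx j 0 : 'cV_m)) 0 0 * bilin g (A *m delta_mx k 0) z) =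
  (w *m (A *m z)) 0 0.
Proof.
move=> ug adjA; rewrite -[A *m z](mulKmx ug) [RHS]mxE.
apply: eq_bigr => j _; rewrite [X in _ * X]mxE big_distrr /=.
apply: eq_bigr => k _.
by rewrite adjA bilin_delta -(colE j w) [(col _ _) _ _]mxE mulrCA.
Qed.

End Bilinear.

Section NHManifold.
Context {R : realType} {n : nat} {M : manifold R (4 * n)}.
Context {H : almost_hypercomplex M} (G : nh_metric H) (D : connection M).
Implicit Types (i : chart_index M) (u x y z : 'cV[R]_(4 * n)).

Lemma nh_metric_unitmx i u : chart_im i u -> G i u \in unitmx.
Proof. by move=> /(metric_signature G)/has_signature_unitmx. Qed.

Lemma Jstr_sqv a i u x : chart_im i u -> H a i u *m (H a i u *m x) = - x.
Proof. by move=> iu; rewrite mulmxA Jstr_sq// mulNmx mul1mx. Qed.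

Lemma Jstr_adjoint a i u x y : chart_im i u ->
  bilin (G i u) (H a i u *m x) y =
  - eps R a * bilin (G i u) x (H a i u *m y).
Proof.
by move=> iu; rewrite (nh_compat G a _ _ iu) Jstr_sqv// bilinNl mulrN mulNr.
Qed.

Lemma Jstr_self_adjoint a i u x y : chart_im i u -> a <> I1 ->
  bilin (G i u) (H a i u *m x) y = bilin (G i u) x (H a i u *m y).
Proof.
by move=> iu; rewrite Jstr_adjoint//; case: a => //= _; rewrite opprK mul1r.
Qed.

Lemma in_W1_W3_sym a i u x y z : in_W1_W3 G D a -> chart_im i u ->
  Ften G D a i u x y z = Ften G D a i u x z y.
Proof.
move=> hW iu; have [A [B [[[_ symA _] _] [[_ symB _] _] FAB]]] := hW i u iu.
by rewrite !FAB symA symB.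
Qed.

(** J_1 is the only skew-adjoint one of the three structures, so the symmetry of
    F_a isolates its coefficient: s J_1 y = 0 for all y, and y = - J_1 v gives
    s v = 0. *)
Lemma qk_form_eq0_scale a c i u x (r s : R) :
    chart_im i u -> in_W1_W3 G D a -> c <> I1 ->
    (forall y, cov_endo D (H a) i u x y =
       r *: (H c i u *m y) + s *: (H I1 i u *m y)) ->
  forall v, s *: v = 0 :> 'cV[R]_(4 * n).
Proof.
move=> iu hW cN1 covE v; rewrite -[v]opprK -(Jstr_sqv I1 v iu) -mulmxN.
apply: (skew_part_eq0 (A := H c i u) (a := r) (nh_metric_unitmx iu)).
- by move=> y z; exact: Defs.metric_sym.
- by move=> y z; exact: Jstr_self_adjoint.
- by move=> y z; rewrite Jstr_adjoint//= mulN1r.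
- move=> y z; have := in_W1_W3_sym x y z hW iu.
  by rewrite /Ften !covE.
Qed.

(** When nabla J_a = w (x) J_c, the Lee form theta_a is w composed with J_c;
    evaluating it at J_c z recovers w up to the sign of J_c^2 = - I. *)
Lemma theta_rank1 a c i u (w : 'rV[R]_(4 * n)) z :
    chart_im i u -> c <> I1 ->
    (forall x y, cov_endo D (H a) i u x y = (w *m x) 0 0 *: (H c i u *m y)) ->
  theta G D a i u (H c i u *m z) = - (w *m z) 0 0.
Proof.
move=> iu cN1 covE.
have -> : - (w *m z) 0 0 = (w *m (H c i u *m (H c i u *m z))) 0 0.
  by rewrite Jstr_sqv// mulmxN [RHS]mxE.
rewrite -(trace12_form_bilin _ _ (nh_metric_unitmx iu)); last first.
  by move=> x y; exact: Jstr_self_adjoint.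
rewrite /theta /trace12; apply: eq_bigr => j _; apply: eq_bigr => k _.
by rewrite /Ften covE bilinZl.
Qed.

Lemma qk_W1_W3_cov (U : set M) (w : hindex -> one_form U) i u x y :
    in_W1_W3 G D I2 -> in_W1_W3 G D I3 -> qk_forms H D w ->
    chart_im i u -> U (point_at i u) ->
  [/\ cov_endo D (H I1) i u x y = 0,
      cov_endo D (H I2) i u x y = form_eval (w I1) i u x *: (H I3 i u *m y) &
      cov_endo D (H I3) i u x y = - form_eval (w I1) i u x *: (H I2 i u *m y)].
Proof.
move=> hW2 hW3 hw iu Uu.
have w3 (v : 'cV[R]_(4 * n)) : - form_eval (w I3) i u x *: v = 0.
  apply: (@qk_form_eq0_scale I2 I3 i u x (form_eval (w I1) i u x)) => // y'.
  by rewrite (hw _ _ _ Cyc231)// scaleNr.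
have w2 (v : 'cV[R]_(4 * n)) : form_eval (w I2) i u x *: v = 0.
  apply: (@qk_form_eq0_scale I3 I2 i u x (- form_eval (w I1) i u x)) => // y'.
  by rewrite (hw _ _ _ Cyc312)// scaleNr addrC.
split.
- by rewrite (hw _ _ _ Cyc123)// w2 subr0 -[LHS]opprK -scaleNr w3 oppr0.
- by rewrite (hw _ _ _ Cyc231)// -scaleNr w3 addr0.
- by rewrite (hw _ _ _ Cyc312)// w2 add0r scaleNr.
Qed.

End NHManifold.

Theorem proposition3p5 (R : realType) (n : nat) (M : manifold R (4 * n))
    (H : almost_hypercomplex M) (G : nh_metric H)
    (D : connection M) (hD : levi_civita G D)
    (hW2 : in_W1_W3 G D I2) (hW3 : in_W1_W3 G D I3)
    (hQK : quaternionic_kahler H D) :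
  in_W0 G D I1 /\
  (forall i (u x y : 'cV[R]_(4 * n)), chart_im i u ->
     cov_endo D (H I1) i u x y = 0) /\
  (forall (U : set M) (w : hindex -> one_form U), open U -> qk_forms H D w ->
   forall i (u x y : 'cV[R]_(4 * n)), chart_im i u -> U (point_at i u) ->
     [/\ cov_endo D (H I2) i u x y =
           form_eval (w I1) i u x *: (H I3 i u *m y),
         form_eval (w I1) i u x = - theta G D I2 i u (H I3 i u *m x),
         cov_endo D (H I3) i u x y =
           - form_eval (w I1) i u x *: (H I2 i u *m y) &
         form_eval (w I1) i u x = theta G D I3 i u (H I2 i u *m x)]).
Proof.
have cov1 i (u x y : 'cV[R]_(4 * n)) : chart_im i u ->
    cov_endo D (H I1) i u x y = 0.
  move=> iu; have [U [w [_ Uu hw]]] := hQK (point_at i u).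
  by have [] := qk_W1_W3_cov x y hW2 hW3 hw iu Uu.
split.
  by move=> i u x y z iu; rewrite /Ften cov1// -(scale0r 0) bilinZl mul0r.
split=> // U w _ hw i u x y iu Uu.
have covE x' y' := qk_W1_W3_cov x' y' hW2 hW3 hw iu Uu.
have [_ cov2 cov3] := covE x y.
split=> //.
- rewrite (theta_rank1 _ (w := w I1 i u))// ?opprK// => x' y'.
  by have [] := covE x' y'.
- rewrite (theta_rank1 _ (w := - w I1 i u))//.
    by rewrite mulNmx [X in - X]mxE opprK.
  move=> x' y'; have [_ _ ->] := covE x' y'.
  by rewrite mulNmx [X in _ = X *: _]mxE.
Qed.
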